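(* Let $n\ge 1$. The graded abelian group $$L^P(\mathrm{Brun}_n)=\bigoplus_{q\ge 1}\bigl(\Gamma_q(P_n)\cap \mathrm{Brun}_n\bigr)/\bigl(\Gamma_{q+1}(P_n)\cap \mathrm{Brun}_n\bigr)$$ is a Lie algebra, namely the graded Lie algebra defined by the filtration $w_B$ on $\mathrm{Brun}_n$, and (via the natural inclusion into $L(P_n)$) it is a two-sided Lie ideal in $L(P_n)$.
   Context: $P_n$ is the pure braid group on $n$ strands of the disc ($P_0$ and $P_1$ are trivial). For $1\le k\le n$, removing the $k$-th strand gives a homomorphism $P_n\to P_{n-1}$; the Brunnian subgroup $\mathrm{Brun}_n\le P_n$ consists of the pure braids that become trivial after removing any one of their strands, i.e. it is the intersection of the kernels of these $n$ homomorphisms. For a group $G$, the descending central series is $\Gamma_1(G)=G$, $\Gamma_{i+1}(G)=[\Gamma_i(G),G]$, with $[a,b]=a^{-1}b^{-1}ab$. The associated graded Lie algebra over $\mathbb{Z}$ is $L(G)=\bigoplus_{i\ge1}L_i(G)$, $L_i(G)=\Gamma_i(G)/\Gamma_{i+1}(G)$, with bracket induced by group commutators. The natural inclusion $L^P(\mathrm{Brun}_n)\hookrightarrow L(P_n)$ is induced by the inclusions $\Gamma_q(P_n)\cap\mathrm{Brun}_n\subseteq\Gamma_q(P_n)$. A filtration on a group $G$ (in the sense of Serre) is a map $w:G\to \mathbb{R}\cup\{+\infty\}$ with $w(1)=+\infty$, $w(x)>0$, $w(xy^{-1})\ge \min(w(x),w(y))$ and $w([x,y])\ge w(x)+w(y)$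 for all $x,y\in G$. For a filtration with values in $\{1,2,\dots\}\cup\{+\infty\}$, the graded Lie algebra it defines is $\bigoplus_{q\ge1}\{x: w(x)\ge q\}/\{x: w(x)\ge q+1\}$ with bracket induced by group commutators. The filtration $w_B$ on $\mathrm{Brun}_n$ is $w_B(b)=\sup\{p\ge 1 : b\in\Gamma_p(P_n)\}$. *)

(* Defs.v *)
From HB Require Import structures.
From mathcomp Require Import all_boot all_order all_algebra generic_quotient.
From mathcomp Require Import all_classical all_reals ereal topology normedtype.
From mathcomp Require Import ring lra zify.
Set Implicit Arguments.
Unset Strict Implicit.
Unset Printing Implicit Defensive.

Import Order.TTheory GRing.Theory Num.Theory.
Import numFieldNormedType.Exports.

Local Open Scope classical_set_scope.
Local Open Scope ring_scope.
Local Open Scope quotient_scope.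

Section Continuity.
Context {R : realType}.
Implicit Types (S T U V : topologicalType).

Lemma within_comp U V T (A : set V) (g : V -> T) (h : U -> V) :
  {within A, continuous g} -> continuous h -> (forall u, A (h u)) ->
  continuous (g \o h).
Proof.
move=> cg ch hA u B /= nB.
have : within A (nbhs (h u)) (g @^-1` B).
  by rewrite nbhs_subspace_in //; exact: cg (h u) B nB.
move=> wB; have : nbhs u [set v | A (h v) -> B (g (h v))] := ch u _ wB.
by apply: filterS => v; apply; exact: hA.
Qed.

Lemma paste V T (u : V -> R) (F G : V -> T) : continuous u ->
  continuous F -> continuous G -> (forall z, u z = 2^-1 -> F z = G z) ->
  continuous (fun z => if u z <= 2^-1 then F z else G z).
Proof.
move=> cu cF cG FG; set h := fun z => _.
have cl1 : closed [set z | u z <= 2^-1].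
  by apply: (@preimage_closed _ _ u [set x | x <= 2^-1]);
    [move=> z _; exact: cu|exact: closed_le].
have cl2 : closed [set z | 2^-1 <= u z].
  by apply: (@preimage_closed _ _ u [set x | 2^-1 <= x]);
    [move=> z _; exact: cu|exact: closed_ge].
have := withinU_continuous (f := h) cl1 cl2.
have -> : [set z | u z <= 2^-1] `|` [set z | 2^-1 <= u z] = setT.
  by apply/seteqP; split=> // z _ /=; case: (lerP (u z) 2^-1) => [|/ltW]; [left|right].
move=> H; apply/continuous_subspace_setT; apply: H.
- apply: (@subspace_eq_continuous _ _ _ F); last exact: continuous_subspaceT.
  by move=> z; rewrite inE /= /h /from_subspace /= => ->.
- apply: (@subspace_eq_continuous _ _ _ G); last exact: continuous_subspaceT.
  move=> z; rewrite inE /= /h /from_subspace /= => uz; case: ifP => // uz'.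
  by rewrite FG //; apply/eqP; rewrite eq_le uz uz'.
Qed.

Lemma ctsC V (c : R) : continuous (fun _ : V => c).
Proof. by move=> z; exact: cvg_cst. Qed.
Lemma ctsD V (f g : V -> R) : continuous f -> continuous g ->
  continuous (fun z => f z + g z).
Proof. by move=> cf cg z; apply: cvgD; [exact: cf|exact: cg]. Qed.
Lemma ctsN V (f : V -> R) : continuous f -> continuous (fun z => - f z).
Proof. by move=> cf z; apply: cvgN; exact: cf. Qed.
Lemma ctsM V (f g : V -> R) : continuous f -> continuous g ->
  continuous (fun z => f z * g z).
Proof. by move=> cf cg z; apply: cvgM; [exact: cf|exact: cg]. Qed.
Lemma ctsmin V (f g : V -> R) : continuous f -> continuous g ->
  continuous (fun z => Num.min (f z) (g z)).
Proof. by move=> cf cg z; apply: continuous_min; [exact: cf|exact: cg]. Qed.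
Lemma ctsmax V (f g : V -> R) : continuous f -> continuous g ->
  continuous (fun z => Num.max (f z) (g z)).
Proof. by move=> cf cg z; apply: continuous_max; [exact: cf|exact: cg]. Qed.
Lemma ctsid V : continuous (fun z : V => z).
Proof. by move=> z; exact: cvg_id. Qed.
Lemma ctsfst U V : continuous (fun z : U * V => z.1).
Proof. by move=> z; exact: cvg_fst. Qed.
Lemma ctssnd U V : continuous (fun z : U * V => z.2).
Proof. by move=> z; exact: cvg_snd. Qed.
Lemma ctspair S U V (f : S -> U) (g : S -> V) : continuous f -> continuous g ->
  continuous (fun z => (f z, g z)).
Proof. by move=> cf cg z; apply: cvg_pair; [exact: cf|exact: cg]. Qed.
Lemma ctscomp S U V (f : S -> U) (g : U -> V) : continuous f -> continuous g ->
  continuous (fun z => g (f z)).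
Proof. by move=> cf cg z; apply: continuous_comp; [exact: cf|exact: cg]. Qed.
End Continuity.

Ltac cts := repeat first [exact: ctsfst | exact: ctssnd | exact: ctsid
  | exact: ctsC | apply: ctsD | apply: ctsN | apply: ctsM | apply: ctsmin
  | apply: ctsmax | apply: ctspair].

Section Loops.
Context {R : realType} {T : topologicalType} (x0 : T).

(* Values outside [0, 1] are irrelevant: homotopic loops are only compared on
   [0, 1]. *)
Record loop := Loop {
  loop_fun :> R -> T;
  loop_cont : {within `[0, 1], continuous loop_fun};
  loop0 : loop_fun 0 = x0;
  loop1 : loop_fun 1 = x0 }.

HB.instance Definition _ := gen_eqMixin loop.
HB.instance Definition _ := gen_choiceMixin loop.

Definition homotopic (f g : loop) := exists H : R * R -> T,
  [/\ {within `[0, 1] `*` `[0, 1], continuous H},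
      forall t, 0 <= t <= 1 -> H (0, t) = f t,
      forall t, 0 <= t <= 1 -> H (1, t) = g t &
      forall s, 0 <= s <= 1 -> H (s, 0) = x0 /\ H (s, 1) = x0].

(* Clamping turns continuity within [0, 1] into global continuity. *)
Definition clamp (t : R) : R := Num.max 0 (Num.min 1 t).

Lemma clamp_id t : 0 <= t <= 1 -> clamp t = t.
Proof. by move=> /andP[t0 t1]; rewrite /clamp min_r // max_r. Qed.

Lemma clamp_itv t : 0 <= clamp t <= 1.
Proof. by rewrite /clamp le_max lexx /= ge_max ler01 ge_min lexx. Qed.

Lemma clamp_cont : continuous clamp.
Proof. by rewrite /clamp; cts. Qed.

Lemma clamp0 : clamp 0 = 0. Proof. by rewrite clamp_id // lexx ler01. Qed.
Lemma clamp1 : clamp 1 = 1. Proof. by rewrite clamp_id // lexx ler01. Qed.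

Lemma loop_clamp_cont (f : loop) : continuous (fun t => f (clamp t)).
Proof.
apply: (@within_comp R R T `[0, 1] f clamp (@loop_cont f) clamp_cont) => t /=.
by rewrite in_itv /= clamp_itv.
Qed.

Lemma loop_contI (F f : R -> T) : continuous F ->
  (forall t, 0 <= t <= 1 -> F t = f t) -> {within `[0, 1], continuous f}.
Proof.
move=> cF Ff; have := @continuous_subspaceT R T `[0, 1] F cF.
apply: subspace_eq_continuous => t; rewrite inE /= in_itv /= => t01.
exact: Ff.
Qed.

Lemma homotopicI (f g : loop) (H : R * R -> T) : continuous H ->
  (forall t, 0 <= t <= 1 -> H (0, t) = f t) ->
  (forall t, 0 <= t <= 1 -> H (1, t) = g t) ->
  (forall s, 0 <= s <= 1 -> H (s, 0) = x0 /\ H (s, 1) = x0) ->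
  homotopic f g.
Proof. by move=> cH *; exists H; split=> //; exact: continuous_subspaceT. Qed.

Lemma homotopicE (f g : loop) : homotopic f g -> exists H : R * R -> T,
  [/\ continuous H,
      forall t, H (0, t) = f (clamp t),
      forall t, H (1, t) = g (clamp t) &
      forall s, H (s, 0) = x0 /\ H (s, 1) = x0].
Proof.
move=> [H [cH H0 H1 Hx]].
exists (fun z => H (clamp z.1, clamp z.2)); split => /=.
- apply: (@within_comp _ _ _ _ H (fun z : R * R => (clamp z.1, clamp z.2))
    cH); last by move=> u /=; rewrite !in_itv /= !clamp_itv.
  by apply: ctspair; apply: ctscomp; cts; exact: clamp_cont.
- by move=> t; rewrite clamp0 H0 ?clamp_itv.
- by move=> t; rewrite clamp1 H1 ?clamp_itv.
- by move=> s; rewrite clamp0 clamp1; exact/Hx/clamp_itv.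
Qed.

Lemma homotopic_reparam (h f g : loop) (phi psi : R -> R) :
  continuous phi -> continuous psi ->
  phi 0 = psi 0 -> phi 1 = psi 1 -> h (clamp (phi 0)) = x0 ->
  h (clamp (phi 1)) = x0 ->
  (forall t, 0 <= t <= 1 -> f t = h (clamp (phi t))) ->
  (forall t, 0 <= t <= 1 -> g t = h (clamp (psi t))) ->
  homotopic f g.
Proof.
move=> cphi cpsi e0 e1 h0 h1 fE gE.
apply: (@homotopicI _ _
  (fun z => h (clamp ((1 - z.1) * phi z.2 + z.1 * psi z.2)))).
- apply: (@ctscomp (R * R)%type R T (fun z => (1 - z.1) * phi z.2 + z.1 * psi z.2)
    (fun t => h (clamp t))); last exact: loop_clamp_cont.
  by cts; apply: ctscomp => //; cts.
- by move=> t t01 /=; rewrite subr0 mul1r mul0r addr0 fE.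
- by move=> t t01 /=; rewrite subrr mul1r mul0r add0r gE.
- move=> s _ /=; rewrite -e0 -e1.
  by split; rewrite -mulrDl subrK mul1r.
Qed.

Lemma homotopic_eq (f g : loop) : f =1 g -> homotopic f g.
Proof.
move=> fg; apply: (@homotopic_reparam f f g id id);
  rewrite ?clamp0 ?clamp1 ?loop0 ?loop1 //.
- by cts.
- by cts.
- by move=> t t01; rewrite clamp_id.
- by move=> t t01; rewrite -fg clamp_id.
Qed.

Lemma homotopic_refl f : homotopic f f. Proof. exact: homotopic_eq. Qed.

Lemma homotopic_sym f g : homotopic f g -> homotopic g f.
Proof.
move=> /homotopicE[H [cH H0 H1 Hx]].
apply: (@homotopicI _ _ (fun z => H (1 - z.1, z.2))).
- by apply: ctscomp => //; cts.
- by move=> t t01 /=; rewrite subr0 H1 clamp_id.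
- by move=> t t01 /=; rewrite subrr H0 clamp_id.
- by move=> s _ /=.
Qed.

Lemma half_gt0 : 0 < 2^-1 :> R. Proof. by rewrite invr_gt0. Qed.
Lemma half_lt1 : 2^-1 < 1 :> R. Proof. by rewrite invf_lt1 // ltr1n. Qed.
Lemma mul2half : 2 * 2^-1 = 1 :> R. Proof. by rewrite divff // pnatr_eq0. Qed.

Lemma homotopic_trans f g h : homotopic f g -> homotopic g h -> homotopic f h.
Proof.
move=> /homotopicE[H [cH H0 H1 Hx]] /homotopicE[K [cK K0 K1 Kx]].
apply: (@homotopicI _ _ (fun z =>
  if z.1 <= 2^-1 then H (2 * z.1, z.2) else K (2 * z.1 - 1, z.2))).
- apply: paste; first by cts.
  + by apply: (@ctscomp _ _ _ (fun z : R * R => (2 * z.1, z.2)) H) => //; cts.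
  + by apply: (@ctscomp _ _ _ (fun z : R * R => (2 * z.1 - 1, z.2)) K) => //; cts.
  by move=> z /= ->; rewrite mul2half subrr H1 K0.
- by move=> t t01 /=; rewrite (ltW half_gt0) mulr0 H0 clamp_id.
- move=> t t01 /=; rewrite leNgt half_lt1 /= (_ : 2 * 1 - 1 = 1); last by lra.
  by rewrite K1 clamp_id.
- by move=> s _ /=; case: ifP => _.
Qed.

Definition loop_cst : loop.
Proof.
by exists (fun _ => x0) => //; apply: continuous_subspaceT; exact: cst_continuous.
Defined.

Definition loop_cat_fun (f g : loop) (t : R) : T :=
  if t <= 2^-1 then f (2 * t) else g (2 * t - 1).

Lemma loop_catE f g t : 0 <= t <= 1 -> loop_cat_fun f g t =
  if t <= 2^-1 then f (clamp (2 * t)) else g (clamp (2 * t - 1)).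
Proof.
move=> t01; rewrite /loop_cat_fun; case: (leP t 2^-1) => th.
  by rewrite clamp_id //; lra.
by rewrite clamp_id //; lra.
Qed.

Lemma loop_cat_clamp_cont (f g : loop) : continuous (fun t : R =>
  if t <= 2^-1 then f (clamp (2 * t)) else g (clamp (2 * t - 1))).
Proof.
apply: paste; [by cts | | |].
- by apply: (@ctscomp R R T (fun t => 2 * t) (fun t => f (clamp t)));
    [cts|exact: loop_clamp_cont].
- by apply: (@ctscomp R R T (fun t => 2 * t - 1) (fun t => g (clamp t)));
    [cts|exact: loop_clamp_cont].
by move=> z ->; rewrite mul2half subrr clamp0 clamp1 loop0 loop1.
Qed.

Definition loop_cat (f g : loop) : loop.
Proof.
exists (loop_cat_fun f g).
- apply: (loop_contI (@loop_cat_clamp_cont f g)) => t t01.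
  by rewrite loop_catE.
- by rewrite /loop_cat_fun (ltW half_gt0) mulr0 loop0.
- by rewrite /loop_cat_fun leNgt half_lt1 /= (_ : 2 * 1 - 1 = 1) ?loop1 //; lra.
Defined.

Definition loop_rev (f : loop) : loop.
Proof.
exists (fun t => f (1 - t)); last 2 first.
- by rewrite subr0 loop1.
- by rewrite subrr loop0.
apply: (@loop_contI (fun t => f (clamp (1 - t)))).
  by apply: (@ctscomp R R T (fun t => 1 - t) (fun t => f (clamp t)));
    [cts|exact: loop_clamp_cont].
by move=> t t01; rewrite clamp_id //; lra.
Defined.

Lemma homotopic_cat f f' g g' : homotopic f f' -> homotopic g g' ->
  homotopic (loop_cat f g) (loop_cat f' g').
Proof.
move=> /homotopicE[H [cH H0 H1 Hx]] /homotopicE[K [cK K0 K1 Kx]].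
apply: (@homotopicI _ _ (fun z =>
  if z.2 <= 2^-1 then H (z.1, 2 * z.2) else K (z.1, 2 * z.2 - 1))).
- apply: paste; first by cts.
  + by apply: (@ctscomp _ _ _ (fun z : R * R => (z.1, 2 * z.2)) H) => //; cts.
  + by apply: (@ctscomp _ _ _ (fun z : R * R => (z.1, 2 * z.2 - 1)) K) => //; cts.
  by move=> z /= ->; rewrite mul2half subrr (Hx _).2 (Kx _).1.
- by move=> t t01 /=; rewrite H0 K0 loop_catE.
- by move=> t t01 /=; rewrite H1 K1 loop_catE.
- move=> s _ /=; rewrite (ltW half_gt0) mulr0 (Hx _).1 leNgt half_lt1 /=.
  by rewrite (_ : 2 * 1 - 1 = 1) ?(Kx _).2 //; lra.
Qed.

Lemma homotopic_rev f g : homotopic f g -> homotopic (loop_rev f) (loop_rev g).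
Proof.
move=> /homotopicE[H [cH H0 H1 Hx]].
apply: (@homotopicI _ _ (fun z => H (z.1, 1 - z.2))).
- by apply: (@ctscomp _ _ _ (fun z : R * R => (z.1, 1 - z.2)) H) => //; cts.
- by move=> t t01 /=; rewrite H0 clamp_id //; lra.
- by move=> t t01 /=; rewrite H1 clamp_id //; lra.
- by move=> s _ /=; rewrite subrr subr0; have [-> ->] := Hx s.
Qed.

Lemma homotopic_catA f g h :
  homotopic (loop_cat f (loop_cat g h)) (loop_cat (loop_cat f g) h).
Proof.
pose phi (t : R) := Num.min (2 * t) (Num.min (t + 4^-1) ((t + 1) / 2)).
have phi1 t : t <= 4^-1 -> phi t = 2 * t.
  by move=> ?; rewrite /phi min_l // le_min; apply/andP; split; lra.
have phi2 t : 4^-1 <= t <= 2^-1 -> phi t = t + 4^-1.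
  by move=> ?; rewrite /phi [X in Num.min _ X]min_l ?min_r //; lra.
have phi3 t : 2^-1 <= t -> phi t = (t + 1) / 2.
  by move=> ?; rewrite /phi [X in Num.min _ X]min_r ?min_r //; lra.
have phi_0 : phi 0 = 0 by rewrite phi1 ?mulr0 // invr_ge0.
have phi_1 : phi 1 = 1 by rewrite phi3; lra.
apply: homotopic_sym.
apply: (@homotopic_reparam (loop_cat f (loop_cat g h)) _ _ phi id).
- by rewrite /phi; cts.
- by cts.
- by [].
- by [].
- by rewrite phi_0 clamp0 loop0.
- by rewrite phi_1 clamp1 loop1.
- move=> t /andP[t0 t1]; rewrite /= /loop_cat_fun /=.
  case: (leP t 4^-1) => t4.
    rewrite phi1 // clamp_id; last by lra.
    have -> : t <= 2^-1 by lra.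
    by rewrite /loop_cat_fun (_ : 2 * t <= 2^-1) //; lra.
  case: (leP t 2^-1) => t2.
    rewrite phi2; last by lra.
    rewrite clamp_id; last by lra.
    rewrite /loop_cat_fun.
    case: leP => ?; first by exfalso; lra.
    case: leP => ?; first by exfalso; lra.
    case: leP => ?; last by exfalso; lra.
    by congr (g _); lra.
  rewrite phi3; last by lra.
  rewrite clamp_id; last by lra.
  rewrite /loop_cat_fun.
  case: leP => ?; first by exfalso; lra.
  case: leP => ?; first by exfalso; lra.
  by congr (h _); lra.
- by move=> t t01; rewrite clamp_id.
Qed.

Lemma homotopic_cst_cat f : homotopic (loop_cat loop_cst f) f.
Proof.
pose phi (t : R) := Num.max 0 (2 * t - 1).
have phi1 t : t <= 2^-1 -> phi t = 0 by move=> ?; rewrite /phi max_l //; lra.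
have phi2 t : 2^-1 <= t -> phi t = 2 * t - 1.
  by move=> ?; rewrite /phi max_r //; lra.
have phi_0 : phi 0 = 0 by rewrite phi1 // invr_ge0.
have phi_1 : phi 1 = 1 by rewrite phi2; lra.
apply: (@homotopic_reparam f _ _ phi id).
- by rewrite /phi; cts.
- by cts.
- by [].
- by [].
- by rewrite phi_0 clamp0 loop0.
- by rewrite phi_1 clamp1 loop1.
- move=> t t01; rewrite /= /loop_cat_fun /=; case: leP => t2.
    by rewrite phi1 // clamp0 loop0.
  by rewrite phi2 ?clamp_id //; lra.
- by move=> t t01; rewrite clamp_id.
Qed.

Lemma homotopic_cat_cst f : homotopic (loop_cat f loop_cst) f.
Proof.
pose phi (t : R) := Num.min 1 (2 * t).
have phi1 t : t <= 2^-1 -> phi t = 2 * t by move=> ?; rewrite /phi min_r //; lra.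
have phi2 t : 2^-1 <= t -> phi t = 1.
  by move=> ?; rewrite /phi min_l //; lra.
have phi_0 : phi 0 = 0 by rewrite phi1 ?mulr0 // invr_ge0.
have phi_1 : phi 1 = 1 by rewrite phi2; lra.
apply: (@homotopic_reparam f _ _ phi id).
- by rewrite /phi; cts.
- by cts.
- by [].
- by [].
- by rewrite phi_0 clamp0 loop0.
- by rewrite phi_1 clamp1 loop1.
- move=> t t01; rewrite /= /loop_cat_fun /=; case: leP => t2.
    by rewrite phi1 // clamp_id //; lra.
  by rewrite phi2 ?clamp1 ?loop1 //; lra.
- by move=> t t01; rewrite clamp_id.
Qed.

Lemma homotopic_cat_rev f : homotopic (loop_cat f (loop_rev f)) loop_cst.
Proof.
pose phi (t : R) := Num.min (2 * t) (2 - 2 * t).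
have phi1 t : t <= 2^-1 -> phi t = 2 * t by move=> ?; rewrite /phi min_l //; lra.
have phi2 t : 2^-1 <= t -> phi t = 2 - 2 * t.
  by move=> ?; rewrite /phi min_r //; lra.
have phi_0 : phi 0 = 0 by rewrite phi1 ?mulr0 // invr_ge0.
have phi_1 : phi 1 = 0 by rewrite phi2; lra.
apply: (@homotopic_reparam f _ _ phi (fun=> 0)).
- by rewrite /phi; cts.
- by cts.
- by [].
- by [].
- by rewrite phi_0 clamp0 loop0.
- by rewrite phi_1 clamp0 loop0.
- move=> t t01; rewrite /= /loop_cat_fun /=; case: leP => t2.
    by rewrite phi1 // clamp_id //; lra.
  by rewrite phi2 ?clamp_id //; [congr (f _); lra|lra|lra].
- by move=> t t01; rewrite clamp0 loop0.
Qed.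

Lemma loop_revK f : loop_rev (loop_rev f) =1 f.
Proof. by move=> t /=; rewrite opprB addrC subrK. Qed.

Lemma homotopic_rev_cat f : homotopic (loop_cat (loop_rev f) f) loop_cst.
Proof.
apply: homotopic_trans (homotopic_cat_rev (loop_rev f)).
apply: homotopic_cat; first exact: homotopic_refl.
by apply: homotopic_eq => t; rewrite loop_revK.
Qed.

Lemma homotopic_equiv : equiv_class_of (fun f g => `[< homotopic f g >]).
Proof.
split=> [f|f g|f g h].
- exact/asboolP/homotopic_refl.
- by apply/asboolP/asboolP; exact: homotopic_sym.
- by move=> /asboolP fg /asboolP gh; apply/asboolP; exact: homotopic_trans gh.
Qed.

Definition homotopic_rel : equiv_rel loop := EquivRelPack homotopic_equiv.

Definition pi1 := {eq_quot homotopic_rel}.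
HB.instance Definition _ := Choice.on pi1.
HB.instance Definition _ := Quotient.on pi1.

Definition pi1_class (f : loop) : pi1 := \pi f.

Lemma pi1_eq f g : pi1_class f = pi1_class g <-> homotopic f g.
Proof.
split=> [/eqP|fg]; first by rewrite eqmodE => /asboolP.
by apply/eqP; rewrite eqmodE; exact/asboolP.
Qed.

Lemma pi1_repr (a : pi1) : pi1_class (repr a) = a. Proof. exact: reprK. Qed.

Lemma pi1_reprK f : homotopic (repr (pi1_class f)) f.
Proof. by apply/pi1_eq; exact: pi1_repr. Qed.

Definition pi1_mul (a b : pi1) := pi1_class (loop_cat (repr a) (repr b)).
Definition pi1_inv (a : pi1) := pi1_class (loop_rev (repr a)).
Definition pi1_one := pi1_class loop_cst.

Lemma pi1_mulE f g :
  pi1_mul (pi1_class f) (pi1_class g) = pi1_class (loop_cat f g).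
Proof. by apply/pi1_eq/homotopic_cat; exact: pi1_reprK. Qed.

Lemma pi1_invE f : pi1_inv (pi1_class f) = pi1_class (loop_rev f).
Proof. by apply/pi1_eq/homotopic_rev; exact: pi1_reprK. Qed.

Lemma pi1_mulA : associative pi1_mul.
Proof.
move=> a b c; rewrite -(pi1_repr a) -(pi1_repr b) -(pi1_repr c) !pi1_mulE.
exact/pi1_eq/homotopic_catA.
Qed.

Lemma pi1_mul1 : left_id pi1_one pi1_mul.
Proof.
by move=> a; rewrite -(pi1_repr a) pi1_mulE; exact/pi1_eq/homotopic_cst_cat.
Qed.

Lemma pi1_mulr1 : right_id pi1_one pi1_mul.
Proof.
by move=> a; rewrite -(pi1_repr a) pi1_mulE; exact/pi1_eq/homotopic_cat_cst.
Qed.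

Lemma pi1_mulV : left_inverse pi1_one pi1_inv pi1_mul.
Proof.
move=> a; rewrite -(pi1_repr a) pi1_invE pi1_mulE.
exact/pi1_eq/homotopic_rev_cat.
Qed.

Lemma pi1_mulrV : right_inverse pi1_one pi1_inv pi1_mul.
Proof.
move=> a; rewrite -(pi1_repr a) pi1_invE pi1_mulE.
exact/pi1_eq/homotopic_cat_rev.
Qed.

HB.instance Definition _ :=
  isGroup.Build pi1 pi1_mulA pi1_mul1 pi1_mulr1 pi1_mulV pi1_mulrV.
End Loops.

Arguments loop R {T} x0.
Arguments pi1 R {T} x0.

Section Functoriality.
Context {R : realType} {T U : topologicalType} (x0 : T).
Variables (h : T -> U) (ch : continuous h).

Definition loop_map (f : loop R x0) : loop R (h x0).
Proof.
exists (fun t => h (f t)); last 2 first.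
- by rewrite loop0.
- by rewrite loop1.
apply: (@loop_contI _ _ (fun t => h (f (clamp t)))).
  by apply: (@ctscomp _ _ _ (fun t => f (clamp t)) h) => //;
    exact: loop_clamp_cont.
by move=> t t01; rewrite clamp_id.
Defined.

Definition pi1_map (a : pi1 R x0) : pi1 R (h x0) :=
  pi1_class (loop_map (repr a)).

Lemma homotopic_map (f g : loop R x0) :
  homotopic f g -> homotopic (loop_map f) (loop_map g).
Proof.
move=> /homotopicE[H [cH H0 H1 Hx]].
apply: (@homotopicI _ _ _ _ _ (fun z => h (H z))).
- exact: (@ctscomp _ _ _ H h).
- by move=> t t01 /=; rewrite H0 clamp_id.
- by move=> t t01 /=; rewrite H1 clamp_id.
- by move=> s _; have [-> ->] := Hx s.
Qed.

Lemma pi1_mapE f : pi1_map (pi1_class f) = pi1_class (loop_map f).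
Proof. by apply/pi1_eq/homotopic_map; exact: pi1_reprK. Qed.

Lemma pi1_map1 : pi1_map 1%g = 1%g.
Proof.
rewrite [1%g in LHS]/(pi1_class (loop_cst x0)) pi1_mapE.
by apply/pi1_eq/homotopic_eq.
Qed.

Lemma pi1_mapM : {morph pi1_map : a b / (a * b)%g}.
Proof.
move=> a b; rewrite -(pi1_repr a) -(pi1_repr b) [(_ * _)%g in LHS]pi1_mulE.
rewrite !pi1_mapE [RHS]pi1_mulE; apply/pi1_eq.
by apply: homotopic_eq => t /=; rewrite /loop_cat_fun /=; case: ifP.
Qed.

HB.instance Definition _ := isMultiplicative.Build _ _ pi1_map pi1_mapM.
HB.instance Definition _ :=
  Multiplicative_isUMagmaMorphism.Build _ _ pi1_map pi1_map1.
End Functoriality.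

Section PureBraids.
Context (R : realType).

(* n distinct points of the closed unit disc, with the topology induced by the
   product topology. *)
Definition config_set (n : nat) : set {ptws 'I_n -> (R * R)%type} :=
  [set c : 'I_n -> (R * R)%type |
    injective c /\ forall i, (c i).1 ^+ 2 + (c i).2 ^+ 2 <= 1].

Arguments config_set n _ : clear implicits.

Definition config n : topologicalType := set_type (config_set n).

Definition config_fun n (c : config n) : 'I_n -> R * R := \val c.

Lemma config_remove_subproof n (k : 'I_n) (c : config n) :
  config_set n.-1 (fun i => config_fun c (lift k i)).
Proof.
have [injc c1] : config_set n (\val c) by exact/set_mem/valP.
by split=> [i j /injc|i]; [exact: lift_inj|exact: c1].
Qed.

Definition config_remove n (k : 'I_n) (c : config n) : config n.-1 :=
  exist (fun c => c \in config_set n.-1) _ (mem_set (config_remove_subproof k c)).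

Lemma config_remove_cont n (k : 'I_n) : continuous (config_remove k).
Proof.
apply: continuous_comp_initial => c.
apply/cvg_sup; first by apply: (@fmap_filter _ _ _ _ (nbhs_filter c)).
move=> i; move: c.
apply: (@continuous_comp_initial _ _ _ (fun f : {ptws 'I_n.-1 -> _} => f i)).
move=> c; apply: (@continuous_comp _ _ _ (set_val : config n -> _)
  (proj (lift k i))).
  exact: initial_continuous.
exact: proj_continuous.
Qed.

(* Points [((i.+1)^-1, 0)]: configurations exist for every n. *)
Lemma config_inhabited n : inhabited (config n).
Proof.
suff H : config_set n (fun i => (i.+1%:R^-1, 0)).
  by exists; exact: (exist (fun c => c \in config_set n) _ (mem_set H)).
split=> [i j [/invr_inj /eqP]|i /=].
  by rewrite eqr_nat eqSS => /eqP /val_inj.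
by rewrite expr0n addr0 exprVn invf_le1 ?exprn_gt0 // -natrX ler1n expn_gt0.
Qed.

(* The pure braid group P_n is the fundamental group of the configuration space;
   the base configuration [q] is arbitrary. *)
Definition pure_braid n (q : config n) := pi1 R q.

(* The target is the model of P_(n-1) based at the n-1 remaining points of [q],
   so that no change of base point is needed. *)
Definition remove_strand n (k : 'I_n) (q : config n) :
    pure_braid q -> pure_braid (config_remove k q) :=
  pi1_map (@config_remove_cont n k).

HB.instance Definition _ n (k : 'I_n) (q : config n) :=
  UMagmaMorphism.copy (@remove_strand n k q) (pi1_map (@config_remove_cont n k)).
End PureBraids.

Section Series.
Context {G : groupType}.
Local Open Scope group_scope.

Definition is_subgroup (A : set G) :=
  A 1 /\ forall x y, A x -> A y -> A (x / y).

Definition generated (A : set G) : set G := smallest is_subgroup A.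

Definition comm_subgroup (A B : set G) : set G :=
  generated [set [~ a, b] | a in A & b in B].

(* Gamma_q for [1 <= q]; the junk value at 0 is the whole group. *)
Definition lcs (q : nat) : set G :=
  iter q.-1 (fun A => comm_subgroup A setT) setT.

(* A descending sequence of subgroups with abelian successive quotients. Only
   the degrees [1 <= p] matter below. *)
Record gseries := GSeries {
  gser :> nat -> set G;
  gser_subgroup : forall p, is_subgroup (gser p);
  gser_decr : forall p, gser p.+1 `<=` gser p;
  gser_comm : forall p x y, gser p x -> gser p y -> gser p.+1 [~ x, y] }.

Lemma subgroupV (A : set G) x : is_subgroup A -> A x -> A x^-1.
Proof. by move=> [A1 AF] Ax; rewrite -[x^-1]mul1g; exact: AF. Qed.

Lemma subgroupM (A : set G) x y : is_subgroup A -> A x -> A y -> A (x * y).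
Proof.
move=> sA Ax Ay; rewrite -[y]invgK; apply: sA.2 => //; exact: subgroupV.
Qed.

Lemma generated_subgroup (A : set G) : is_subgroup (generated A).
Proof.
split=> [B [[]]//|x y Ax Ay B BA]; have [sB _] := BA.
by apply: sB.2; [exact: Ax|exact: Ay].
Qed.

Lemma lcs_subgroup q : is_subgroup (lcs q).
Proof. by case: q => [|[|q]]; [split|split|exact: generated_subgroup]. Qed.

Lemma lcs_comm q x y : lcs q x -> lcs q.+1 [~ x, y].
Proof.
case: q => [|q] lx; first by [].
by move=> B [_ sB]; apply: sB; exists x => //; exists y.
Qed.

Lemma lcs_decr q : lcs q.+1 `<=` lcs q.
Proof.
case: q => [//|]; elim=> [//|q IH] x lx B [sB AB]; apply: lx; split=> //.
by move=> _ [a la [b _ <-]]; apply: AB; exists a; [exact: IH|exists b].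
Qed.

Definition lcs_series : gseries :=
  GSeries lcs_subgroup lcs_decr (fun p x y lx _ => lcs_comm y lx).
End Series.
Arguments gseries G : clear implicits.
Arguments lcs G q _ : clear implicits.
Arguments lcs_series G : clear implicits.

Section GradedPiece.
Context {G : groupType} (S : gseries G) (p : nat).
Local Open Scope group_scope.

Definition gcoset (x : G) : set G := [set x * b | b in S p.+1].

(* The quotient S p / S p.+1, whose elements are cosets. *)
Definition gpiece : Type :=
  {C : set G | `[< exists2 x, S p x & C = gcoset x >]}.
HB.instance Definition _ := Choice.on gpiece.

Lemma gclass_subproof x :
  `[< exists2 y, S p y & gcoset (if `[< S p x >] then x else 1) = gcoset y >].
Proof.
apply/asboolP; case: asboolP => Sx; first by exists x.
by exists 1 => //; exact: (gser_subgroup S p).1.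
Qed.

(* The class of [x], meant for [x] in [S p]; the zero class otherwise. *)
Definition gclass (x : G) : gpiece :=
  exist _ (gcoset (if `[< S p x >] then x else 1)) (gclass_subproof x).

(* A chosen representative. Choosing 1 in the zero class makes brackets with 0
   vanish, whatever the series. *)
Definition grepr (c : gpiece) : G :=
  if c == gclass 1 then 1 else xget 1 [set x | S p x /\ gclass x = c].

Lemma gcosetP x y : gcoset x = gcoset y <-> S p.+1 (x^-1 * y).
Proof.
have sS := gser_subgroup S p.+1; split=> [xy|Sxy].
  have : gcoset y y by exists 1; [exact: sS.1|exact: mulg1].
  by rewrite -xy => -[b Sb <-]; rewrite mulKg.
apply/seteqP; split=> _ [b Sb <-].
  exists ((x^-1 * y)^-1 * b); last by rewrite invgM invgK -!mulgA mulVKg.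
  by apply: subgroupM => //; exact: subgroupV.
by exists (x^-1 * y * b); [exact: subgroupM|rewrite -!mulgA mulVKg].
Qed.

Lemma gclassP x y : S p x -> S p y -> gclass x = gclass y <-> S p.+1 (x^-1 * y).
Proof.
move=> Sx Sy; rewrite -gcosetP; split=> [/(congr1 val)/=|xy].
  by rewrite !asboolT.
by apply: val_inj => /=; rewrite !asboolT.
Qed.

Lemma grepr1 : grepr (gclass 1) = 1. Proof. by rewrite /grepr eqxx. Qed.

Lemma grepr_in c : S p (grepr c) /\ gclass (grepr c) = c.
Proof.
rewrite /grepr; case: eqP => [->|_]; first by split; first exact: (gser_subgroup S p).1.
apply: (@xgetPex _ 1 [set x | S p x /\ gclass x = c]); case: c => C PC; have /asboolP[x Sx Cx] := PC.
by exists x; split=> //; apply: val_inj; rewrite /= asboolT.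
Qed.

Lemma greprP c : S p (grepr c). Proof. exact: (grepr_in c).1. Qed.
Lemma greprK c : gclass (grepr c) = c. Proof. exact: (grepr_in c).2. Qed.

Lemma grepr_class x : S p x -> S p.+1 ((grepr (gclass x))^-1 * x).
Proof. by move=> Sx; apply/gclassP=> //; [exact: greprP|exact: greprK]. Qed.

Definition gpiece_add (c d : gpiece) := gclass (grepr c * grepr d).
Definition gpiece_opp (c : gpiece) := gclass (grepr c)^-1.

Let sp := gser_subgroup S p.
Let sp1 := gser_subgroup S p.+1.

Lemma gpiece_addE x y : S p x -> S p y ->
  gpiece_add (gclass x) (gclass y) = gclass (x * y).
Proof.
move=> Sx Sy; apply/gclassP; [by apply: subgroupM => //; exact: greprP|exact: subgroupM|].
set a := grepr _; set b := grepr _.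
have Sa : S p.+1 (a^-1 * x) by exact: grepr_class.
have Sb : S p.+1 (b^-1 * y) by exact: grepr_class.
have -> : (a * b)^-1 * (x * y) = (a^-1 * x) * [~ a^-1 * x, b] * (b^-1 * y).
  by rewrite /commg /conjg; rewrite ?gnorm.
do 2! [apply: subgroupM => //].
by apply: gser_comm; [exact: gser_decr|exact: greprP].
Qed.

Lemma gpiece_oppE x : S p x -> gpiece_opp (gclass x) = gclass x^-1.
Proof.
move=> Sx; apply/gclassP; [by apply: subgroupV => //; exact: greprP|exact: subgroupV|].
set a := grepr _.
have Sa : S p.+1 (a^-1 * x) by exact: grepr_class.
have -> : a^-1^-1 * x^-1 = [~ a^-1, x] * (a^-1 * x)^-1.
  by rewrite /commg /conjg; rewrite ?gnorm.
apply: subgroupM => //; last exact: subgroupV.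
apply: gser_comm => //; apply: subgroupV => //; exact: greprP.
Qed.

Lemma gpiece_addA : associative gpiece_add.
Proof.
move=> a b c; rewrite -(greprK a) -(greprK b) -(greprK c).
by rewrite !gpiece_addE ?mulgA //; try exact: greprP;
  apply: subgroupM => //; exact: greprP.
Qed.

Lemma gpiece_addC : commutative gpiece_add.
Proof.
move=> a b; rewrite -(greprK a) -(greprK b) !gpiece_addE; try exact: greprP.
apply/gclassP; try by apply: subgroupM => //; exact: greprP.
rewrite (_ : _ * _ = [~ grepr b, grepr a]).
  by apply: gser_comm; exact: greprP.
by rewrite /commg /conjg; rewrite ?gnorm.
Qed.

Lemma gpiece_add0 : left_id (gclass 1) gpiece_add.
Proof.
by move=> a; rewrite -(greprK a) gpiece_addE ?mul1g //; [exact: sp.1|exact: greprP].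
Qed.

Lemma gpiece_addN : left_inverse (gclass 1) gpiece_opp gpiece_add.
Proof.
move=> a; rewrite -(greprK a) gpiece_oppE ?gpiece_addE ?mulVg //;
  by [exact: greprP|apply: subgroupV => //; exact: greprP].
Qed.

HB.instance Definition _ := GRing.isZmodule.Build gpiece
  gpiece_addA gpiece_addC gpiece_add0 gpiece_addN.
End GradedPiece.

Section Graded.
Context {G : groupType} (S : gseries G).

(* The direct sum over the degrees [1 <= p]: the index [i] stands for degree
   [i.+1]. *)
Record graded := Graded {
  gr_fun :> forall i, gpiece S i.+1;
  gr_fin : exists N, forall i, (N <= i)%N -> gr_fun i = 0 }.

HB.instance Definition _ := gen_eqMixin graded.
HB.instance Definition _ := gen_choiceMixin graded.

Lemma gradedP (f g : graded) : (forall i, f i = g i) -> f = g.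
Proof.
case: f g => [f Hf] [g Hg] /= fg.
have e : f = g by apply: functional_extensionality_dep.
by rewrite e in Hf *; congr Graded; exact: Prop_irrelevance.
Qed.

Lemma gr_zero_fin : exists N, forall i, (N <= i)%N -> (0 : gpiece S i.+1) = 0.
Proof. by exists 0%N. Qed.

Lemma gr_add_fin (f g : graded) :
  exists N, forall i, (N <= i)%N -> f i + g i = 0.
Proof.
have [N fN] := gr_fin f; have [M gM] := gr_fin g.
exists (maxn N M) => i; rewrite geq_max => /andP[/fN -> /gM ->].
by rewrite addr0.
Qed.

Lemma gr_opp_fin (f : graded) : exists N, forall i, (N <= i)%N -> - f i = 0.
Proof. by have [N fN] := gr_fin f; exists N => i /fN ->; rewrite oppr0. Qed.

Definition gr_zero := Graded gr_zero_fin.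
Definition gr_add f g := Graded (gr_add_fin f g).
Definition gr_opp f := Graded (gr_opp_fin f).

Lemma gr_addA : associative gr_add.
Proof. by move=> f g h; apply: gradedP => i /=; rewrite addrA. Qed.
Lemma gr_addC : commutative gr_add.
Proof. by move=> f g; apply: gradedP => i /=; rewrite addrC. Qed.
Lemma gr_add0 : left_id gr_zero gr_add.
Proof. by move=> f; apply: gradedP => i /=; rewrite add0r. Qed.
Lemma gr_addN : left_inverse gr_zero gr_opp gr_add.
Proof. by move=> f; apply: gradedP => i /=; rewrite addNr. Qed.

HB.instance Definition _ :=
  GRing.isZmodule.Build graded gr_addA gr_addC gr_add0 gr_addN.

Lemma gr_in_fin p x : exists N, forall i, (N <= i)%N ->
  (if i.+1 == p then gclass S i.+1 x else 0) = 0.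
Proof. by exists p => i pi; rewrite gtn_eqF. Qed.

(* The homogeneous element of degree [p] given by the class of [x]. *)
Definition gr_in p x := Graded (gr_in_fin p x).

(* The bracket induced by group commutators, for [r = p + q]. See [gr_bracket_in]
   for the independence of the representatives. *)
Definition piece_bracket p q r (c : gpiece S p) (d : gpiece S q) :
    gpiece S r :=
  gclass S r [~ grepr c, grepr d]%g.

Lemma piece_bracket0 p q r (d : gpiece S q) :
  piece_bracket r (0 : gpiece S p) d = 0.
Proof. by rewrite /piece_bracket grepr1 comm1g. Qed.

Lemma piece_bracket0r p q r (c : gpiece S p) :
  piece_bracket r c (0 : gpiece S q) = 0.
Proof. by rewrite /piece_bracket grepr1 commg1. Qed.

Definition gr_bracket_fun (f g : graded) i : gpiece S i.+1 :=
  \sum_(a < i.+1) \sum_(b < i.+1 | (a.+1 + b.+1 == i.+1)%N)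
    piece_bracket i.+1 (f a) (g b).

Lemma gr_bracket_fin (f g : graded) :
  exists N, forall i, (N <= i)%N -> gr_bracket_fun f g i = 0.
Proof.
have [N fN] := gr_fin f; have [M gM] := gr_fin g.
exists (N + M)%N => i NMi; apply: big1 => a _; apply: big1 => b /eqP ab.
have [/fN ->|aN] := leqP N a; first by rewrite piece_bracket0.
by rewrite gM ?piece_bracket0r //; lia.
Qed.

Definition gr_bracket f g := Graded (gr_bracket_fin f g).
End Graded.

(* Lie algebras over the integers. *)
Definition is_lie_bracket (L : zmodType) (br : L -> L -> L) :=
  [/\ forall x y z, br (x + y) z = br x z + br y z,
      forall x y z, br x (y + z) = br x y + br x z,
      forall x, br x x = 0 &
      forall x y z, br x (br y z) + br y (br z x) + br z (br x y) = 0].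

Definition lie_ideal (L : zmodType) (br : L -> L -> L) (I : set L) :=
  [/\ I 0, forall x y, I x -> I y -> I (x - y) &
      forall x z, I x -> I (br x z) /\ I (br z x)].

Section GradedMap.
Context {G H : groupType} (h : UMagmaMorphism.type G H).
Variables (S : gseries G) (T : gseries H).

Lemma gr_map_fin (f : graded S) : exists N, forall i, (N <= i)%N ->
  gclass T i.+1 (h (grepr (f i))) = 0.
Proof.
have [N fN] := gr_fin f; exists N => i /fN ->.
by rewrite grepr1 gmulf1.
Qed.

(* Induced by [h], when [h] maps [S] into [T]. *)
Definition gr_map (f : graded S) : graded T := Graded (gr_map_fin f).

Lemma gr_map_in p x : (forall y, S p y -> T p (h y)) ->
  (forall y, S p.+1 y -> T p.+1 (h y)) -> S p x ->
  gr_map (gr_in S p x) = gr_in T p (h x).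
Proof.
move=> hp hp1 Sx; apply: gradedP => i /=; case: eqP => [ip|_]; last first.
  by rewrite grepr1 gmulf1.
rewrite -{p}ip in hp hp1 Sx *.
apply/gclassP; [exact/hp/greprP|exact: hp|].
rewrite -gmulfV -gmulfM; apply: hp1; exact: grepr_class.
Qed.
End GradedMap.
Arguments gr_map {G H} h S T f.

Section Filtration.
Local Open Scope ereal_scope.
Context (R : realType) (G : groupType).

Definition is_filtration (w : G -> \bar R) :=
  [/\ w 1%g = +oo, forall x, 0 < w x,
      forall x y, mine (w x) (w y) <= w (x / y)%g &
      forall x y, w x + w y <= w [~ x, y]%g].

(* Filtrations with values in {1, 2, ...} and +oo. *)
Record nfiltration := NFiltration {
  nfilt :> G -> \bar R;
  nfilt_filtration : is_filtration nfilt;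
  nfilt_nat : forall x,
    nfilt x = +oo \/ exists2 p : nat, (0 < p)%N & nfilt x = p%:R%:E }.

Variable w : nfiltration.

Definition level (p : nat) : set G := [set x | p%:R%:E <= w x].

Lemma level_subgroup p : is_subgroup (level p).
Proof.
have [w1 _ wF _] := nfilt_filtration w.
split=> [|x y px py]; rewrite /level /= ?w1 ?leey //.
by apply: le_trans (wF x y); rewrite le_min px py.
Qed.

Lemma level_decr p : level p.+1 `<=` level p.
Proof. by move=> x; apply: le_trans; rewrite lee_fin ler_nat. Qed.

Lemma level_comm p x y : level p x -> level p y -> level p.+1 [~ x, y]%g.
Proof.
have [_ w0 _ wC] := nfilt_filtration w; rewrite /level /= => px py.
apply: le_trans (wC x y).
have w1 z : 1%:E <= w z.
  have [->|[q q0 ->]] := nfilt_nat w z; first by rewrite leey.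
  by rewrite lee_fin ler1n.
by rewrite -natr1 EFinD leeD.
Qed.

Definition filtration_series : gseries G :=
  GSeries level_subgroup level_decr level_comm.
End Filtration.

Section StronglyCentral.
Context {G : groupType}.
Local Open Scope group_scope.

(* This makes the commutator bracket well defined on classes. *)
Definition strongly_central (S : gseries G) := forall p q x y,
  (0 < p)%N -> (0 < q)%N -> S p x -> S q y -> S (p + q)%N [~ x, y].

Lemma lcs_conj q x y : lcs G q x -> lcs G q (x ^ y).
Proof.
move=> lx; rewrite -[x ^ y](mulVKg x) -commgEl.
by apply: subgroupM; [exact: lcs_subgroup|done|apply: lcs_decr; exact: lcs_comm].
Qed.

Lemma commMg_conj (x x' y : G) : [~ x * x', y] = [~ x, y] ^ x' * [~ x', y].
Proof. by rewrite /commg /conjg; rewrite ?gnorm. Qed.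

Lemma commVg_conj (x y : G) : [~ x^-1, y] = ([~ x, y] ^ x^-1)^-1.
Proof. by rewrite /commg /conjg; rewrite ?gnorm. Qed.

Lemma invg_comm_swap (x y : G) : [~ x, y]^-1 = [~ y, x].
Proof. by rewrite /commg /conjg; rewrite ?gnorm. Qed.

Lemma hall_witt (a b y : G) : [~ [~ a, b], y] =
  (([~ [~ b^-1, y^-1], a] ^ y * [~ [~ y, a^-1], b^-1] ^ a)^-1) ^ b.
Proof. by rewrite /commg /conjg; rewrite ?gnorm. Qed.

Lemma lcs_strongly_central : strongly_central (lcs_series G).
Proof.
move=> p q x y p0 + lx ly; case: p p0 lx => // p _ /=.
elim: p q x y ly => [|p IH] q x y ly lx q0.
  by rewrite -invg_comm_swap; apply: subgroupV; [exact: lcs_subgroup|exact: lcs_comm].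
have sN := lcs_subgroup (G := G) (p.+2 + q).
suff sub : lcs G p.+2 `<=` [set u | lcs G (p.+2 + q) [~ u, y]] by exact: sub.
move=> {lx}x lx; apply: lx; split.
  split=> [|u v /= lu lv]; first by rewrite /= comm1g; exact: sN.1.
  rewrite commMg_conj commVg_conj.
  apply: (subgroupM sN); first exact: lcs_conj.
  by apply: (subgroupV sN); exact: lcs_conj.
move=> _ [a la [b _ <-]] /=; rewrite hall_witt.
apply: lcs_conj; apply: (subgroupV sN).
have ly' : lcs G q y^-1 by apply: subgroupV => //; exact: lcs_subgroup.
have la' : lcs G p.+1 a^-1 by apply: subgroupV => //; exact: lcs_subgroup.
apply: (subgroupM sN); apply: lcs_conj.
  rewrite -invg_comm_swap; apply: (subgroupV sN).
  rewrite (_ : (p.+2 + q)%N = (p.+1 + q.+1)%N); last by rewrite addnS.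
  apply: IH => //; rewrite -invg_comm_swap.
  by apply: subgroupV; [exact: lcs_subgroup|exact: lcs_comm].
rewrite addSn; apply: lcs_comm; rewrite -invg_comm_swap; apply: subgroupV.
  exact: lcs_subgroup.
exact: IH.
Qed.

Variable S : gseries G.
Hypothesis sS : strongly_central S.

Lemma piece_bracketE p q x y : (0 < p)%N -> (0 < q)%N -> S p x -> S q y ->
  piece_bracket (p + q)%N (gclass S p x) (gclass S q y) =
  gclass S (p + q) [~ x, y].
Proof.
move=> p0 q0 Sx Sy; set a := gclass S p x; set b := gclass S q y.
have Sa : S p (grepr a) by exact: greprP.
have Sb : S q (grepr b) by exact: greprP.
have sub := gser_subgroup S.
have nrm r u v : S r u -> (0 < r)%N -> forall t, (0 < t)%N -> S t v -> S r (u ^ v).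
  move=> Su r0 t t0 Sv; rewrite -[u ^ v](mulVKg u) -commgEl.
  apply: (subgroupM (sub r)) => //.
  have : S (r + t)%N [~ u, v] by exact: sS.
  elim: t {t0 Sv} => [|t IHt]; first by rewrite addn0.
  by rewrite addnS => /gser_decr.
have comm_r (u v v' : G) : [~ u, v * v'] = [~ u, v'] * [~ u, v] ^ v'.
  by rewrite /commg /conjg; rewrite ?gnorm.
apply/gclassP; [exact: sS|exact: sS|].
have xE : x = grepr a * ((grepr a)^-1 * x) by rewrite mulVKg.
have yE : y = grepr b * ((grepr b)^-1 * y) by rewrite mulVKg.
have Sm : S p.+1 ((grepr a)^-1 * x) by exact: grepr_class.
have Sn : S q.+1 ((grepr b)^-1 * y) by exact: grepr_class.
move: (grepr a) (grepr b) ((grepr a)^-1 * x) ((grepr b)^-1 * y) Sa Sb Sm Sn xE yE.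
move=> u v m k Su Sv Sm Sk xE yE; rewrite xE yE in Sx Sy *.
rewrite commMg_conj [in X in _ * (X ^ _ * _)]comm_r.
set X := [~ u, v].
rewrite (_ : _ * _ = ([~ u, k] ^ m) ^ X * [~ X, k * m] * [~ m, v * k]);
  last by rewrite /commg /conjg ?gnorm.
have S1 t z : (0 < t)%N -> S t z -> S 1%N z.
  by case: t => // t _; elim: t => // t IHt /gser_decr.
have SX : S (p + q)%N X by exact: sS.
have pq0 : (0 < p + q)%N by lia.
apply: (subgroupM (sub _)); first apply: (subgroupM (sub _)).
- apply: (nrm _ _ _ _ _ (p + q)%N) => //; apply: (nrm _ _ _ _ _ p.+1) => //.
  by rewrite -addnS; exact: sS.
- rewrite -addn1; apply: sS => //; apply: (subgroupM (sub _)).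
    exact: S1 Sk.
  exact: S1 Sm.
- by rewrite -addSn; exact: sS.
Qed.

Lemma gr_bracket_in p q x y : (0 < p)%N -> (0 < q)%N -> S p x -> S q y ->
  gr_bracket (gr_in S p x) (gr_in S q y) = gr_in S (p + q) [~ x, y].
Proof.
move=> p0 q0 Sx Sy; apply: gradedP => i /=; rewrite /gr_bracket_fun.
case: eqP => [ipq|ipq]; last first.
  apply: big1 => a _; apply: big1 => b /eqP ab /=.
  case: eqP => [ap|_]; last by rewrite piece_bracket0.
  case: eqP => [bq|_]; last by rewrite piece_bracket0r.
  by exfalso; lia.
have pi : (p.-1 < i.+1)%N by lia.
have qi : (q.-1 < i.+1)%N by lia.
rewrite (bigD1 (Ordinal pi)) //= [X in (_ + X)%R]big1 => [|a /eqP ap]; last first.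
  apply: big1 => b _; case: eqP => [ap'|_]; last by rewrite piece_bracket0.
  by case: ap; apply: val_inj => /=; lia.
rewrite addr0 (bigD1 (Ordinal qi)) /=; last by apply/eqP; lia.
rewrite [X in (_ + X)%R]big1 => [|b /andP[_ /eqP bq]]; last first.
  have /negPf -> : b.+1 != q.
    by apply/eqP => bq'; apply: bq; apply: val_inj => /=; lia.
  by rewrite piece_bracket0r.
rewrite addr0 !prednK // !eqxx ipq; exact: piece_bracketE.
Qed.
End StronglyCentral.

Definition is_graded_lie (G : groupType) (S : gseries G) :=
  strongly_central S /\ is_lie_bracket (@gr_bracket G S).

Section Brunnian.
Context {R : realType} {n : nat} (q : config R n).

Definition brunnian_pred : {pred pure_braid q} :=
  [pred b | `[< forall k : 'I_n, remove_strand k b = 1%g >]].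

Lemma brunnian_closed : group_closed brunnian_pred.
Proof.
split=> [|a b /asboolP a1 /asboolP b1]; apply/asboolP => k.
  exact: gmulf1.
by rewrite gmulfF /= a1 b1 divg1.
Qed.

Definition brunnian : Type := {b : pure_braid q | brunnian_pred b}.
HB.instance Definition _ := SubChoice.on brunnian.
HB.instance Definition _ :=
  SubChoice_isSubGroup.Build _ brunnian_pred brunnian brunnian_closed.

(* Gamma_p(P_n) intersected with Brun_n, as a subset of Brun_n. *)
Definition brunnian_lcs (p : nat) : set brunnian :=
  [set b | lcs (pure_braid q) p (val b)].

Lemma brunnian_lcs_subgroup p : is_subgroup (brunnian_lcs p).
Proof.
have [l1 lF] := lcs_subgroup (G := pure_braid q) p.
by split=> [|x y lx ly]; [exact: l1|exact: (lF _ _ lx ly)].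
Qed.

Lemma brunnian_lcs_decr p : brunnian_lcs p.+1 `<=` brunnian_lcs p.
Proof. by move=> b; exact: lcs_decr. Qed.

Lemma brunnian_lcs_comm p x y : brunnian_lcs p x -> brunnian_lcs p y ->
  brunnian_lcs p.+1 [~ x, y]%g.
Proof. by move=> lx _; exact: (lcs_comm (val y) lx). Qed.

Definition brunnian_series : gseries brunnian :=
  GSeries brunnian_lcs_subgroup brunnian_lcs_decr brunnian_lcs_comm.

Definition wB (b : brunnian) : \bar R :=
  ereal_sup [set p%:R%:E |
    p in [set p | (1 <= p)%N /\ lcs (pure_braid q) p (val b)]].

Definition LP_brunnian : zmodType := graded brunnian_series.
Definition L_pure_braid : zmodType := graded (lcs_series (pure_braid q)).

Definition LP_incl : LP_brunnian -> L_pure_braid :=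
  gr_map (val : brunnian -> pure_braid q) brunnian_series
    (lcs_series (pure_braid q)).
End Brunnian.

(* Main.v *)
Require Import Defs.
From HB Require Import structures.
From mathcomp Require Import all_boot all_order all_algebra.
From mathcomp Require Import all_classical all_reals ereal topology normedtype.
From mathcomp Require Import zify.
Set Implicit Arguments.
Unset Strict Implicit.
Unset Printing Implicit Defensive.

Import Order.TTheory GRing.Theory Num.Theory.
Local Open Scope classical_set_scope.
Local Open Scope ring_scope.

(** Everything follows from two facts about the series Gamma_p(P_n): it is
strongly central, [Gamma_p, Gamma_q] lies in Gamma_(p + q), and Brun_n, an
intersection of kernels, is normal in P_n.

For any strongly central series S of a group, the commutator induces a Lie
bracket on the associated graded group ([graded_lie]). Every graded element is
a sum of homogeneous classes ([graded_ind]), so each axiom reduces to an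
identity between commutators modulo deeper terms: bilinearity to the expansion
of [~ x * x', y], the Jacobi identity to the Hall-Witt identity, whose
conjugations act trivially on classes.

If S is the preimage of T under a homomorphism h, then S inherits strong
centrality from T, and the induced map of graded Lie algebras is injective
because both S p and S p.+1 are the preimages of the corresponding terms of
T. If moreover the image of h is normal, then [~ h x, z] = (h x)^-1 * (h x)^z is
again in that image, so the image of the graded map is an ideal
([gr_map_ideal]). This applies to the inclusion of Brun_n in P_n.

Finally, w_B is the depth of an element in the series Gamma_p(P_n) /\ Brun_n.
The depth of x is at least p exactly when x lies in the p-th term
([depth_ge]), so the depth function determines the series, and its being a
filtration in the sense of Serre is strong centrality once more. *)

(** * The Lie algebra of a strongly central series *)

Section Series.
Context {G : groupType} (S : gseries G).
Implicit Types (f g : graded S) (x y : G).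

Lemma gser_le p r x : (p <= r)%N -> S r x -> S p x.
Proof.
move=> /subnK <-; elim: (r - p)%N => [//|k IH].
by rewrite addSn => /gser_decr.
Qed.

Lemma gr_in_add p x y : S p x -> S p y ->
  gr_in S p (x * y)%g = gr_in S p x + gr_in S p y.
Proof.
move=> Sx Sy; apply: gradedP => i /=; case: eqP => [ip|_]; last first.
  by rewrite addr0.
by rewrite -{p}ip in Sx Sy *; symmetry; exact: gpiece_addE.
Qed.

Lemma gr_in_eq0 p x : S p.+1 x -> gr_in S p x = 0.
Proof.
move=> Sx; apply: gradedP => i /=; case: eqP => // ip.
rewrite -{p}ip in Sx *; apply/gclassP; first exact: gser_decr.
  exact: (gser_subgroup S _).1.
rewrite mulg1; apply: subgroupV => //; exact: gser_subgroup.
Qed.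

Lemma gr_in_inv p x : S p x -> gr_in S p x^-1%g = - gr_in S p x.
Proof.
move=> Sx; apply/eqP; rewrite -addr_eq0 -gr_in_add //; last first.
  by apply: subgroupV => //; exact: gser_subgroup.
by rewrite mulVg gr_in_eq0 //; exact: (gser_subgroup S _).1.
Qed.

(** A graded element has finitely many nonzero components, hence is the sum of
its homogeneous parts; identities that are additive in each variable need only
be checked on classes. *)
Lemma graded_ind (P : graded S -> Prop) : P 0 ->
  (forall f g, P f -> P g -> P (f + g)) ->
  (forall p x, (0 < p)%N -> S p x -> P (gr_in S p x)) -> forall f, P f.
Proof.
move=> P0 PD Pin f; have [N fN] := gr_fin f.
have -> : f = \sum_(j < N) gr_in S j.+1 (grepr (f j)).
  apply: gradedP => i.
  have E (F : 'I_N -> graded S) : (\sum_j F j) i = \sum_j F j i.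
    exact: (big_morph (fun g : graded S => g i)).
  rewrite E /=; have [iN|iN] := ltnP i N.
    rewrite (bigD1 (Ordinal iN)) //= eqxx greprK big1 ?addr0 // => j.
    by rewrite eqSS -val_eqE /= eq_sym => /negPf ->.
  by rewrite fN // big1 // => j _; rewrite eqSS gtn_eqF //; exact: leq_trans iN.
by elim/big_ind: _ => // j _; apply: Pin => //; exact: greprP.
Qed.

Hypothesis sS : strongly_central S.

Lemma gser_conj p x y : (0 < p)%N -> S p x -> S 1%N y -> S p (x ^ y)%g.
Proof.
move=> p0 Sx Sy; rewrite -[(x ^ y)%g](mulVKg x) -commgEl.
apply: (subgroupM (gser_subgroup S p)) => //; apply: gser_decr.
by rewrite -addn1; exact: sS.
Qed.

(** A conjugate of [x] differs from [x] by the deeper element [~ x, y]. *)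
Lemma gr_in_conj p x y : (0 < p)%N -> S p x -> S 1%N y ->
  gr_in S p (x ^ y)%g = gr_in S p x.
Proof.
move=> p0 Sx Sy; have Sc : S p.+1 [~ x, y]%g by rewrite -addn1; exact: sS.
rewrite -[(x ^ y)%g](mulVKg x) -commgEl gr_in_add //; last exact: gser_decr.
by rewrite (gr_in_eq0 Sc) addr0.
Qed.

(** Since [~ x * x', y] = [~ x, y] ^ x' * [~ x', y], the error term is
conjugate to the inverse of [~ [~ x, y], x'], which lies deeper. *)
Lemma piece_bracketDl p q r (c c' : gpiece S p) (d : gpiece S q) :
  (0 < p)%N -> (0 < q)%N -> (p + q)%N = r ->
  piece_bracket r (c + c') d = piece_bracket r c d + piece_bracket r c' d.
Proof.
move=> p0 q0 <-; rewrite -(greprK c) -(greprK c') -(greprK d).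
move: (greprP c) (greprP c') (greprP d).
move: (grepr c) (grepr c') (grepr d) => x x' y Sx Sx' Sy.
have sub := gser_subgroup S.
rewrite [_ + _ in LHS]gpiece_addE // !piece_bracketE //; last exact: subgroupM.
rewrite [RHS]gpiece_addE; try exact: sS.
have Sxy : S (p + q)%N [~ x, y]%g by exact: sS.
have Sxy' : S (p + q)%N [~ x', y]%g by exact: sS.
have Sc : S (p + q).+1%N [~ [~ x, y], x']%g.
  by apply: (@gser_le _ (p + q + p)%N); [lia|apply: sS => //; lia].
have pq0 : (0 < p + q)%N by lia.
rewrite commMg_conj; set u := [~ x, y]%g in Sc Sxy *; set v := [~ x', y]%g.
apply/gclassP; [|exact: subgroupM|].
  by apply: subgroupM => //; apply: gser_conj => //; exact: gser_le Sx'.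
have -> : ((u ^ x' * v)^-1 * (u * v) = ([~ u, x']^-1) ^ v)%g.
  by rewrite /commg /conjg; rewrite ?gnorm.
apply: gser_conj => //; first exact: subgroupV.
exact: gser_le Sxy'.
Qed.

Lemma piece_bracketC p q r (c : gpiece S p) (d : gpiece S q) :
  (0 < p)%N -> (0 < q)%N -> (p + q)%N = r ->
  piece_bracket r c d = - piece_bracket r d c.
Proof.
move=> p0 q0 <-; rewrite -(greprK c) -(greprK d) piece_bracketE;
  [|exact: sS|by []|by []|exact: greprP|exact: greprP].
rewrite (addnC p q) piece_bracketE;
  [|exact: sS|by []|by []|exact: greprP|exact: greprP].
rewrite -invg_comm_swap [RHS]gpiece_oppE //.
by apply: sS => //; exact: greprP.
Qed.

Lemma gr_bracketDl f f' g :
  gr_bracket (f + f') g = gr_bracket f g + gr_bracket f' g.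
Proof.
apply: gradedP => i; rewrite /= /gr_bracket_fun -big_split; apply: eq_bigr => a _.
rewrite -big_split; apply: eq_bigr => b /eqP ab /=.
exact: piece_bracketDl.
Qed.

Lemma gr_bracketC f g : gr_bracket f g = - gr_bracket g f.
Proof.
apply: gradedP => i; rewrite /= /gr_bracket_fun.
under eq_bigr do rewrite big_mkcond.
rewrite exchange_big -sumrN; apply: eq_bigr => b _.
rewrite -sumrN [RHS]big_mkcond; apply: eq_bigr => a _ /=.
rewrite addnC; case: eqP => // ab; apply: piece_bracketC => //.
by rewrite addnC.
Qed.

Lemma gr_bracketDr f g g' :
  gr_bracket f (g + g') = gr_bracket f g + gr_bracket f g'.
Proof. by rewrite gr_bracketC gr_bracketDl opprD -!gr_bracketC. Qed.

Lemma gr_bracket0l g : gr_bracket 0 g = 0.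
Proof. by apply: (addrI (gr_bracket 0 g)); rewrite -gr_bracketDl !addr0. Qed.

Lemma gr_bracket0r f : gr_bracket f 0 = 0.
Proof. by rewrite gr_bracketC gr_bracket0l oppr0. Qed.

Lemma gr_bracketNr f g : gr_bracket f (- g) = - gr_bracket f g.
Proof.
by apply/eqP; rewrite -addr_eq0 -gr_bracketDr addNr gr_bracket0r.
Qed.

Lemma gr_bracketxx f : gr_bracket f f = 0.
Proof.
elim/graded_ind: f => [|f g ff gg|p x p0 Sx]; first exact: gr_bracket0l.
  rewrite gr_bracketDl !gr_bracketDr ff gg addr0 add0r.
  by rewrite [X in X + _]gr_bracketC addNr.
rewrite gr_bracket_in // commgg gr_in_eq0 //; exact: (gser_subgroup S _).1.
Qed.

(** The sum is the class of the product of the three factors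
[~ [~ x, y^-1], z] ^ y of the Hall-Witt identity, and that product is 1. *)
Lemma gr_jacobi_in p q r x y z : (0 < p)%N -> (0 < q)%N -> (0 < r)%N ->
  S p x -> S q y -> S r z ->
  let f := gr_in S p x in let g := gr_in S q y in let h := gr_in S r z in
  gr_bracket f (gr_bracket g h) + gr_bracket g (gr_bracket h f) +
    gr_bracket h (gr_bracket f g) = 0.
Proof.
move=> p0 q0 r0 Sx Sy Sz f g h.
(* The two signs, from the inverse of v and from swapping the outer bracket,
   cancel. *)
have term a b c u v w : (0 < a)%N -> (0 < b)%N -> (0 < c)%N ->
    S a u -> S b v -> S c w ->
    gr_bracket (gr_in S c w) (gr_bracket (gr_in S a u) (gr_in S b v)) =
    gr_in S (a + b + c)%N ([~ [~ u, v^-1], w] ^ v)%g.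
  move=> a0 b0 c0 Su Sv Sw.
  have Sv' : S b v^-1%g by apply: subgroupV => //; exact: gser_subgroup.
  have Suv : S (a + b)%N [~ u, v^-1]%g by exact: sS.
  have ab0 : (0 < a + b)%N by lia.
  rewrite gr_in_conj; [|lia|exact: sS|exact: gser_le Sv].
  rewrite -gr_bracket_in // -gr_bracket_in // gr_in_inv //.
  by rewrite gr_bracketNr [RHS]gr_bracketC gr_bracketNr opprK.
have Scj a b c u v w : (0 < a)%N -> (0 < b)%N -> (0 < c)%N ->
    S a u -> S b v -> S c w ->
    S (a + b + c)%N ([~ [~ u, v^-1], w] ^ v)%g.
  move=> a0 b0 c0 Su Sv Sw.
  have Sv' : S b v^-1%g by apply: subgroupV => //; exact: gser_subgroup.
  apply: gser_conj; [lia| |exact: gser_le Sv].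
  by apply: sS => //; [lia|exact: sS].
rewrite /f /g /h (term q r p y z x) // (term r p q z x y) // (term p q r x y z) //.
rewrite (_ : q + r + p = p + q + r)%N; last lia.
rewrite (_ : r + p + q = p + q + r)%N; last lia.
have S1 := Scj _ _ _ _ _ _ p0 q0 r0 Sx Sy Sz.
have S2 := Scj _ _ _ _ _ _ q0 r0 p0 Sy Sz Sx.
have S3 := Scj _ _ _ _ _ _ r0 p0 q0 Sz Sx Sy.
rewrite (_ : q + r + p = p + q + r)%N in S2; last lia.
rewrite (_ : r + p + q = p + q + r)%N in S3; last lia.
have sub := gser_subgroup S.
rewrite -!gr_in_add //; last exact: subgroupM.
rewrite gr_in_eq0 // (_ : (_ * _)%g = 1%g); first exact: (sub _).1.
by rewrite /commg /conjg; rewrite ?gnorm.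
Qed.

Lemma gr_jacobi f g h :
  gr_bracket f (gr_bracket g h) + gr_bracket g (gr_bracket h f) +
    gr_bracket h (gr_bracket f g) = 0.
Proof.
elim/graded_ind: f => [|f f' IH IH'|p x p0 Sx].
- by rewrite !(gr_bracket0l, gr_bracket0r) !addr0.
- rewrite !(gr_bracketDl, gr_bracketDr) [X in X + _ = 0]addrACA [LHS]addrACA.
  by rewrite IH IH' addr0.
elim/graded_ind: g => [|g g' IH IH'|q y q0 Sy].
- by rewrite !(gr_bracket0l, gr_bracket0r) !addr0.
- rewrite !(gr_bracketDl, gr_bracketDr) [X in X + _ = 0]addrACA [LHS]addrACA.
  by rewrite IH IH' addr0.
elim/graded_ind: h => [|h h' IH IH'|r z r0 Sz].
- by rewrite !(gr_bracket0l, gr_bracket0r) !addr0.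
- rewrite !(gr_bracketDl, gr_bracketDr) [X in X + _ = 0]addrACA [LHS]addrACA.
  by rewrite IH IH' addr0.
exact: gr_jacobi_in.
Qed.

Lemma graded_lie : is_graded_lie S.
Proof.
split=> //; split; [exact: gr_bracketDl|exact: gr_bracketDr|exact: gr_bracketxx|].
exact: gr_jacobi.
Qed.
End Series.

(** * Series pulled back along a homomorphism *)

Section Preimage.
Context {G H : groupType} (h : UMagmaMorphism.type G H).
Variables (S : gseries G) (T : gseries H).
Hypothesis SE : forall p x, S p x = T p (h x).
Implicit Types f g : graded S.

Let hS p x : S p x -> T p (h x). Proof. by rewrite SE. Qed.

Lemma strongly_central_preimage : strongly_central T -> strongly_central S.
Proof.
move=> sT p q x y p0 q0; rewrite !SE => Sx Sy.
by rewrite gmulfR; exact: sT.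
Qed.

(** The class of [h x] vanishes only if [h x] lies in [T p.+1], that is, if [x]
lies in [S p.+1]. *)
Lemma gr_map_inj : injective (gr_map h S T).
Proof.
move=> f g fg; apply: gradedP => i.
have /(gclassP (hS (greprP (f i))) (hS (greprP (g i)))) :
  gr_map h S T f i = gr_map h S T g i by rewrite fg.
rewrite -gmulfV -gmulfM -SE => fgi; rewrite -(greprK (f i)) -(greprK (g i)).
by apply/gclassP => //; exact: greprP.
Qed.

Lemma gr_mapD f g : gr_map h S T (f + g) = gr_map h S T f + gr_map h S T g.
Proof.
apply: gradedP => i /=.
have [Sf Sg] := (greprP (f i), greprP (g i)).
have Sfg : S i.+1 (grepr (f i) * grepr (g i))%g.
  by apply: subgroupM => //; exact: gser_subgroup.
rewrite -[RHS]/(gpiece_add _ _) gpiece_addE; try exact: hS.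
rewrite -gmulfM; apply/gclassP; [exact/hS/greprP|exact: hS|].
by rewrite -gmulfV -gmulfM -SE; exact: grepr_class.
Qed.

Lemma gr_map0 : gr_map h S T 0 = 0.
Proof. by apply: (addrI (gr_map h S T 0)); rewrite -gr_mapD !addr0. Qed.

Lemma gr_mapB f g : gr_map h S T (f - g) = gr_map h S T f - gr_map h S T g.
Proof. by apply: (addIr (gr_map h S T g)); rewrite -gr_mapD !subrK. Qed.

Lemma gr_map_gr_in p x : S p x -> gr_map h S T (gr_in S p x) = gr_in T p (h x).
Proof. by apply: gr_map_in => y; exact: hS. Qed.

Hypothesis sT : strongly_central T.
Let sS := strongly_central_preimage sT.

Lemma gr_map_bracket f g : gr_map h S T (gr_bracket f g) =
  gr_bracket (gr_map h S T f) (gr_map h S T g).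
Proof.
elim/(@graded_ind _ S): f => [|f f' IH IH'|p x p0 Sx].
- by rewrite !(gr_map0, gr_bracket0l).
- by rewrite gr_mapD !gr_bracketDl // gr_mapD IH IH'.
elim/(@graded_ind _ S): g => [|g g' IH IH'|q y q0 Sy].
- by rewrite !(gr_map0, gr_bracket0r).
- by rewrite gr_mapD !gr_bracketDr // gr_mapD IH IH'.
rewrite gr_bracket_in // !gr_map_gr_in //; last exact: sS.
by rewrite gr_bracket_in // ?gmulfR //; exact: hS.
Qed.

Hypothesis normal_h : forall x z, exists y, h y = (h x ^ z)%g.

(** On homogeneous classes the bracket is the class of
[~ h x, z] = (h x)^-1 * (h x) ^ z, which normality puts in the image of [h]. *)
Lemma gr_map_range_bracket (f : graded S) (z : graded T) :
  range (gr_map h S T) (gr_bracket (gr_map h S T f) z).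
Proof.
elim/(@graded_ind _ S): f => [|f f' [u _ fu] [u' _ fu']|p x p0 Sx].
- by exists 0 => //; rewrite gr_map0 gr_bracket0l.
- by exists (u + u') => //; rewrite !gr_mapD gr_bracketDl // fu fu'.
elim/(@graded_ind _ T): z => [|z z' [u _ zu] [u' _ zu']|q z q0 Tz].
- by exists 0 => //; rewrite gr_map0 gr_bracket0r.
- by exists (u + u') => //; rewrite !gr_mapD gr_bracketDr // zu zu'.
have [y yE] := normal_h x z.
have hyE : h (x^-1 * y)%g = [~ h x, z]%g by rewrite gmulfM gmulfV yE commgEl.
exists (gr_in S (p + q)%N (x^-1 * y)%g) => //.
rewrite gr_map_gr_in // ?SE hyE; last by apply: sT => //; exact: hS.
by rewrite gr_map_gr_in // gr_bracket_in //; exact: hS.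
Qed.

Lemma gr_map_ideal : lie_ideal (@gr_bracket _ T) (range (gr_map h S T)).
Proof.
split; first by exists 0 => //; exact: gr_map0.
  by move=> _ _ [f _ <-] [g _ <-]; exists (f - g) => //; exact: gr_mapB.
move=> _ z [f _ <-]; split; first exact: gr_map_range_bracket.
have [u _ uE] := gr_map_range_bracket f z.
by exists (0 - u) => //; rewrite gr_mapB gr_map0 uE sub0r -gr_bracketC.
Qed.
End Preimage.

(** * The filtration attached to a series *)

Lemma gseries_eq (G : groupType) (S T : gseries G) :
  (S : nat -> set G) = T -> S = T.
Proof.
case: S T => [S s1 s2 s3] [T t1 t2 t3] /= E.
by rewrite E in s1 s2 s3 *; congr GSeries; exact: Prop_irrelevance.
Qed.

Section Depth.
Local Open Scope ereal_scope.
Context (R : realType) {G : groupType} (S : gseries G).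

Definition depth (x : G) : \bar R :=
  ereal_sup [set p%:R%:E | p in [set p | (1 <= p)%N /\ S p x]].

Hypothesis S0 : S 0%N = setT.
Hypothesis S1 : S 1%N = setT.

(** A finite supremum of integers is attained, and the terms decrease. The
degree 0 is covered because [S 0] is everything and depths are positive, the
latter because [S 1] is everything. *)
Lemma depth_ge p x : (p%:R%:E <= depth x) = `[< S p x >].
Proof.
apply/idP/asboolP => [px|Sx]; last first.
  case: p Sx => [_|p Sx].
    apply: (@le_trans _ _ 1%:E); first by rewrite lee_fin ler01.
    by apply: ereal_sup_ubound; exists 1%N => //; rewrite /= S1.
  by apply: ereal_sup_ubound; exists p.+1.
case: p px => [_|p px]; first by rewrite S0.
apply: contrapT => NSx.
suff : depth x <= p%:R%:E.
  by move=> /(le_trans px); rewrite lee_fin ler_nat ltnn.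
apply: ge_ereal_sup => _ [r [_ Sr] <-]; rewrite lee_fin ler_nat leqNgt.
by apply/negP => pr; apply: NSx; exact: gser_le Sr.
Qed.

Lemma depth_natVinfty x :
  depth x = +oo \/ exists2 p : nat, (0 < p)%N & depth x = p%:R%:E.
Proof.
have [all_S|/existsNP[N NS]] := pselect (forall p, S p x).
  left; apply/eqyP => A _.
  have [N AN] : exists N : nat, (A <= N%:R)%R.
    exists (Num.bound `|A|%R); apply: le_trans (ler_norm A) (ltW _).
    exact: archi_boundP (normr_ge0 A).
  apply: (@le_trans _ _ N%:R%:E); first by rewrite lee_fin.
  by rewrite depth_ge; exact/asboolP.
right; have Sx1 : exists p, `[< S p x >] by exists 1%N; rewrite S1; exact/asboolP.
have Sx_le p : `[< S p x >] -> (p <= N)%N.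
  move=> /asboolP Sp; rewrite leqNgt; apply/negP => Np; apply: NS.
  by apply: gser_le Sp; exact: ltnW.
case: (ex_maxnP Sx1 Sx_le) => p Sp pmax.
exists p; first by apply: pmax; rewrite S1; exact/asboolP.
apply/eqP; rewrite eq_le depth_ge Sp andbT; apply: ge_ereal_sup => _ [r [_ Sr] <-].
by rewrite lee_fin ler_nat; apply: pmax; exact/asboolP.
Qed.

Lemma depth_le x y :
  (forall p, S p x -> S p y) -> depth x <= depth y.
Proof.
move=> Sxy; apply: le_ereal_sup => _ [p [p1 Sp] <-]; exists p => //.
by split=> //; exact: Sxy.
Qed.

(** The bound on the depth of a commutator is strong centrality in finite
depths. If one argument has infinite depth, then the commutator lies in terms
of arbitrarily large degree. *)
Lemma depth_filtration : strongly_central S -> is_filtration depth.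
Proof.
move=> sS; have sub := gser_subgroup S.
have ge1 x : 1 <= depth x by rewrite (depth_ge 1); apply/asboolP; rewrite S1.
split=> [|x|x y|x y].
- have [//|[p p0 E]] := depth_natVinfty 1%g.
  have : p.+1%:R%:E <= depth 1%g.
    by rewrite depth_ge; apply/asboolP; exact: (sub _).1.
  by rewrite E lee_fin ler_nat ltnn.
- exact: lt_le_trans (ge1 x).
- have [xy|/ltW yx] := leP (depth x) (depth y); apply: depth_le => p Sp.
    apply: (sub p).2 => //; apply/asboolP; rewrite -depth_ge.
    by apply: le_trans xy; rewrite depth_ge; exact/asboolP.
  apply: (sub p).2 => //; apply/asboolP; rewrite -depth_ge.
  by apply: le_trans yx; rewrite depth_ge; exact/asboolP.
have SC p r : (0 < p)%N -> (0 < r)%N ->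
    p%:R%:E <= depth x -> r%:R%:E <= depth y ->
    (p + r)%:R%:E <= depth [~ x, y]%g.
  move=> p0 r0; rewrite !depth_ge => /asboolP Sx /asboolP Sy.
  by apply/asboolP; exact: sS.
have inf u : (forall p : nat, (0 < p)%N -> p%:R%:E <= depth u) -> depth u = +oo.
  move=> pu; have [//|[p p0 E]] := depth_natVinfty u.
  by have := pu p.+1 isT; rewrite E lee_fin ler_nat ltnn.
have [Ex|[p p0 Ex]] := depth_natVinfty x.
  rewrite [leRHS]inf ?leey // => p p0.
  rewrite (le_trans _ (SC p 1%N p0 isT _ (ge1 y))) //.
    by rewrite lee_fin ler_nat leq_addr.
  by rewrite Ex leey.
have [Ey|[r r0 Ey]] := depth_natVinfty y.
  rewrite [leRHS]inf ?leey // => r r0.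
  rewrite (le_trans _ (SC 1%N r isT r0 (ge1 x) _)) //.
    by rewrite lee_fin ler_nat leq_addl.
  by rewrite Ey leey.
by rewrite Ex Ey -EFinD -natrD; apply: SC => //; rewrite ?Ex ?Ey.
Qed.

Definition depth_nfiltration (sS : strongly_central S) : nfiltration R G :=
  NFiltration (depth_filtration sS) depth_natVinfty.

Lemma depth_series (sS : strongly_central S) :
  filtration_series (depth_nfiltration sS) = S.
Proof.
have E : level (depth_nfiltration sS) = S.
  apply/funext => p; apply/seteqP; split=> x.
    by rewrite /level /= depth_ge => /asboolP.
  by move=> Sx; rewrite /level /= depth_ge; exact/asboolP.
exact: gseries_eq.
Qed.
End Depth.

(** * Brunnian braids *)

Theorem proposition2p2 (R : realType) (n : nat) (hn : (1 <= n)%N)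
    (q : config R n) :
  [/\ exists w : nfiltration R (brunnian q),
        (forall b, w b = wB b) /\ filtration_series w = brunnian_series q,
      is_graded_lie (brunnian_series q),
      injective (@LP_incl _ _ q),
      (forall x y : LP_brunnian q,
        LP_incl (x + y) = LP_incl x + LP_incl y /\
        LP_incl (gr_bracket x y) = gr_bracket (LP_incl x) (LP_incl y)) &
      lie_ideal (@gr_bracket _ (lcs_series (pure_braid q)))
        (range (@LP_incl _ _ q))].
Proof.
have SE p x : brunnian_series q p x =
  lcs_series (pure_braid q) p ((val : brunnian q -> pure_braid q) x) by [].
have sT := @lcs_strongly_central (pure_braid q).
have sS : strongly_central (brunnian_series q).
  exact: strongly_central_preimage SE sT.
have ST p : (p <= 1)%N -> brunnian_series q p = setT by case: p => [|[]].
split.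
- exists (depth_nfiltration R (ST 0%N isT) (ST 1%N isT) sS).
  by split=> //; exact: depth_series.
- exact: graded_lie.
- exact: gr_map_inj SE.
- by move=> x y; split; [exact: gr_mapD|exact: gr_map_bracket].
- apply: gr_map_ideal => // b z.
  have zb : brunnian_pred (val b ^ z)%g.
    apply/asboolP => k; have /asboolP/(_ k) bk := valP b.
    by rewrite gmulfJ /= bk conj1g.
  by exists (@exist _ (fun c => is_true (brunnian_pred c)) _ zb : brunnian q).
Qed.
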